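(* Let $(X,\Sigma,\lambda)$ be a positive measure space and let $f,g\in L_\infty(X)$ be non-zero. Then $f\perp_B g$ if and only if $$0\in\operatorname{conv}\left\{z\in\mathbb{K}:\ \lambda\left(\{x\in X:|f(x)|>\|f\|_\infty-\epsilon,\ |\overline{f(x)}g(x)-z|<\epsilon\}\right)>0\ \text{ for all }\epsilon>0\right\}.$$
   Context: $\mathbb{K}$ is $\mathbb{R}$ or $\mathbb{C}$. $L_\infty(X)=L_\infty^{\mathbb{K}}(X,\Sigma,\lambda)$ is the space of essentially bounded measurable $\mathbb{K}$-valued functions (modulo a.e. equality) with the essential supremum norm $\|\cdot\|_\infty$; the measure is arbitrary (no finiteness or $\sigma$-finiteness is assumed). In a normed space over $\mathbb{K}$, $x\perp_B y$ (Birkhoff-James orthogonality) means $\|x+\alpha y\|\ge\|x\|$ for all $\alpha\in\mathbb{K}$. $\operatorname{conv}$ denotes the convex hull in $\mathbb{K}$. *)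

(* Defs.v *)
From HB Require Import structures.
From mathcomp Require Import all_boot all_order all_algebra complex.
From mathcomp Require Import all_classical all_reals all_analysis.

Set Implicit Arguments.
Unset Strict Implicit.
Unset Printing Implicit Defensive.

Import Order.TTheory GRing.Theory Num.Theory.
Import numFieldNormedType.Exports.

Local Open Scope classical_set_scope.
Local Open Scope ring_scope.

Variant scalar_kind := RealScalars | ComplexScalars.

Definition scalars (R : realType) (k : scalar_kind) : numFieldType :=
  match k with
  | RealScalars => R
  | ComplexScalars => R[i]
  end.

(* The norm of [scalars R k] as a [numFieldType] takes values in
   [scalars R k] itself; [modulus] is the same absolute value, [R]-valued. *)
Definition modulus (R : realType) (k : scalar_kind) : scalars R k -> R :=
  match k with
  | RealScalars => fun x : R => `|x|
  | ComplexScalars => fun z : R[i] => complex.Re `|z|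
  end.

Definition conjugate (R : realType) (k : scalar_kind) :
    scalars R k -> scalars R k :=
  match k with
  | RealScalars => fun x : R => x
  | ComplexScalars => fun z : R[i] => conjc z
  end.

Definition borel (K : numFieldType) := g_sigma_algebraType (@open K).

(* The coefficients in [convex_set] range over [{i01 K}]; for [K = R[i]] the
   order is the partial order in which [0 <= t] forces [t] to be real, so these
   are exactly the real numbers of the unit interval. *)
Definition convex_hull (K : numFieldType) (A : set K) : set K :=
  smallest (@convex_set K K^o) A.

(* [N] is the norm, or the seminorm inducing it on a quotient of [V]. *)
Definition birkhoff_james (R : realType) (K : numFieldType) (V : lmodType K)
    (N : V -> \bar R) (x y : V) :=
  forall a : K, (N x <= N (x + a *: y)%R)%E.

Section Linfty.
Context {d : measure_display} {X : measurableType d} {R : realType}.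
Variables (k : scalar_kind) (mu : {measure set X -> \bar R}).
Local Notation K := (scalars R k).
Implicit Types f g : X -> K.

Definition Linfty_norm f : \bar R :=
  Lnorm mu +oo%E (EFin \o (@modulus R k \o f)).

(* Elements of the space L_oo are given by representatives, as everywhere
   defined functions; [f] is zero in L_oo when [f = cst 0 %[ae mu]]. *)
Definition Linfty : set (X -> K) :=
  [set f | measurable_fun setT (f : X -> borel K) /\
           finite_norm mu +oo%E (@modulus R k \o f)].

Definition norming_values f g : set K :=
  [set z | forall e : R, 0 < e ->
    (0 < mu [set x | (Linfty_norm f - e%:E < (modulus (f x))%:E)%E /\
                     (modulus (conjugate (f x) * g x - z) < e)%R])%E].

End Linfty.

(* Main.v *)
Require Import Defs.
From HB Require Import structures.
From mathcomp Require Import all_boot all_order all_algebra complex.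
From mathcomp Require Import all_classical all_reals all_analysis.
From mathcomp Require Import measurable_realfun ess_sup_inf ring lra.

(**
Write phi = conj(f) g, let M and G be the norms of f and g, and let S be the
set of values in the statement: the essential cluster values of phi along the
sets on which |f| is close to M. Everything rests on the identity
  |f + a g|^2 = |f|^2 + 2 Re (a phi) + |a g|^2.

If 0 lies in the convex hull of S, then no open half-plane Re (a z) < 0
contains S, so for each a there is z in S with Re (a z) >= 0
([convex_hull_half_plane]). On the set of positive measure attached to z and to
a small e, |f| > M - e and Re (a phi) is almost nonnegative, so the identity
makes |f + a g| there nearly as large as M
([norming_half_plane_birkhoff]).

Conversely let f be orthogonal to g and fix a. Applying orthogonality to the
perturbations f + t a g with t > 0 small, there is a set of positive measure on
which |f + t a g| > M - t^2; dividing the identity by t shows that on it |f| is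
close to M and Re (a phi) is almost nonnegative ([large_perturbation]). As phi
is essentially bounded, it has an essential cluster value along those sets
([essential_cluster_exists]), and this value is a point z of S with
Re (a z) >= 0 ([birkhoff_norming_half_plane]). So S meets every closed
half-plane with 0 on its boundary.

It remains to see that a compact plane set S with this property has 0 in its
convex hull ([planar_convex_compact_zero]). Since the hull is not known to be
closed, it is not separated from 0 directly. Instead one takes the point p of
least norm on the segments joining two points of S. If p is not 0, a point z of
S with <p, z> <= 0, together with one of the two ends of the segment through p,
gives a segment crossing the line R p: either beyond 0 as seen from p, which
puts 0 in the hull, or between 0 and p, which contradicts the choice of p.

The two scalar fields are treated together, through real and imaginary parts,
the imaginary part being 0 over the reals. *)

Set Implicit Arguments.
Unset Strict Implicit.
Unset Printing Implicit Defensive.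

Import Order.TTheory GRing.Theory Num.Theory.
Import numFieldNormedType.Exports.

Local Open Scope classical_set_scope.
Local Open Scope ring_scope.

(** * Convex hulls of compact sets in the plane *)

Section ConvexHullOfPlanarCompact.
Variable R : realType.
Implicit Types (a b p q : R * R) (t : R) (S C : set (R * R)).

Definition segment_point t a b : R * R :=
  ((1 - t) * a.1 + t * b.1, (1 - t) * a.2 + t * b.2).
Definition dot a b : R := a.1 * b.1 + a.2 * b.2.
Definition cross a b : R := a.1 * b.2 - a.2 * b.1.

Lemma exists_min_norm_segment S : S !=set0 -> compact S ->
  exists a b t, [/\ S a, S b, 0 <= t <= 1 &
    forall a' b' t', S a' -> S b' -> 0 <= t' <= 1 ->
     dot (segment_point t a b) (segment_point t a b) <=
     dot (segment_point t' a' b') (segment_point t' a' b')].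
Proof.
move=> [s Ss] Scomp.
pose D := (S `*` S) `*` [set` `[(0:R), 1]].
have Dcomp : compact D.
  apply: compact_setX; first exact: compact_setX.
  exact: segment_compact.
pose f (u : (R * R) * (R * R) * R) : R :=
  dot (segment_point u.2 u.1.1 u.1.2) (segment_point u.2 u.1.1 u.1.2).
have fcont : continuous f.
  move=> u; rewrite /f /dot /segment_point/=.
  have c1 : (fun u : (R * R) * (R * R) * R => u.1.1.1) @ u --> u.1.1.1.
    exact: (cvg_comp _ _ (cvg_comp _ _ cvg_fst cvg_fst) cvg_fst).
  have c2 : (fun u : (R * R) * (R * R) * R => u.1.1.2) @ u --> u.1.1.2.
    exact: (cvg_comp _ _ (cvg_comp _ _ cvg_fst cvg_fst) cvg_snd).
  have c3 : (fun u : (R * R) * (R * R) * R => u.1.2.1) @ u --> u.1.2.1.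
    exact: (cvg_comp _ _ (cvg_comp _ _ cvg_fst cvg_snd) cvg_fst).
  have c4 : (fun u : (R * R) * (R * R) * R => u.1.2.2) @ u --> u.1.2.2.
    exact: (cvg_comp _ _ (cvg_comp _ _ cvg_fst cvg_snd) cvg_snd).
  have c5 : (fun u : (R * R) * (R * R) * R => u.2) @ u --> u.2.
    exact: cvg_snd.
  have c6 : (fun u : (R * R) * (R * R) * R => 1 - u.2) @ u --> 1 - u.2.
    by apply: cvgB => //; exact: cvg_cst.
  by apply: cvgD; apply: cvgM; apply: cvgD; apply: cvgM.
have D0 : D !=set0.
  by exists ((s, s), 0); split=> //=; rewrite in_itv/= lexx ler01.
have [c] := compact_EVT_min D0 Dcomp (continuous_subspaceT fcont).
rewrite inE => -[[/= Sa Sb]]; rewrite in_itv/= => ct cmin.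
exists c.1.1, c.1.2, c.2; split=> // a' b' t' Sa' Sb' t'01.
by apply: (cmin ((a', b'), t')); rewrite inE; split=> //=; rewrite in_itv.
Qed.

(** First-order optimality: the squared norm along the segment has derivative
    [2 * (dot p b - dot p p)] at [p]. *)
Lemma dot_ge_of_min_norm p b :
  (forall t, 0 <= t <= 1 ->
     dot p p <= dot (segment_point t p b) (segment_point t p b)) ->
  dot p p <= dot p b.
Proof.
move=> pmin; rewrite leNgt; apply/negP => lt_bp.
pose v := (b.1 - p.1, b.2 - p.2).
pose g := dot p p - dot p b.
have g0 : 0 < g by rewrite subr_gt0.
have v0 : 0 <= dot v v by rewrite /dot -!expr2 addr_ge0 ?sqr_ge0.
have D0 : 0 < dot v v + g by rewrite ltr_wpDl.
(* small enough for the linear term of the expansion below to dominate *)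
pose t := g / (dot v v + g).
have tD : t * (dot v v + g) = g by rewrite /t divfK ?gt_eqF.
have t0 : 0 < t by rewrite divr_gt0.
have t1 : t <= 1 by rewrite ler_pdivrMr// mul1r lerDr.
have := pmin t; rewrite t1 ltW// => /(_ isT).
have -> : dot (segment_point t p b) (segment_point t p b) =
   dot p p - 2 * t * g + t * (t * dot v v).
  by rewrite /g /v /dot /segment_point/=; ring.
have -> : t * dot v v = g - t * g by rewrite -[X in X - _]tD; ring.
have : 0 < t * g by rewrite mulr_gt0.
have : 0 <= t * (t * g) 
  by apply: mulr_ge0; [|apply: mulr_ge0]; exact: ltW.
lra.
Qed.

(** The sign of [cross p] tells on which side of the line spanned by [p] a point
    lies. The bound [t < 1] keeps the crossing point away from [w]. *)
Lemma segment_crosses_line p z w :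
  cross p w != 0 -> cross p z * cross p w <= 0 ->
  exists2 t, 0 <= t < 1 & cross p (segment_point t z w) = 0.
Proof.
set x := cross p z; set y := cross p w => y0 xy.
have yx0 : y - x != 0.
  rewrite subr_eq0; apply: contra_neq y0 => yx.
  move: xy; rewrite -yx -expr2 => y2.
  by apply/eqP; rewrite -sqrf_eq0 eq_le y2 sqr_ge0.
have xy0 : x - y != 0 by rewrite -opprB oppr_eq0.
have xy2 : 0 < (x - y) ^+ 2 by rewrite exprn_even_gt0.
have y2 : 0 < y ^+ 2 by rewrite exprn_even_gt0.
(* the solution t of (1 - t) * x + t * y = 0 *)
exists (x / (x - y)); last first.
  transitivity ((1 - x / (x - y)) * x + x / (x - y) * y).
    by rewrite /x /y /cross /segment_point/=; ring.
  by field.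
apply/andP; split.
  rewrite -(pmulr_rge0 _ xy2).
  have -> : (x - y) ^+ 2 * (x / (x - y)) = x ^+ 2 - x * y by field.
  by rewrite subr_ge0 (le_trans xy) ?sqr_ge0.
rewrite -subr_gt0 -(pmulr_rgt0 _ xy2).
have -> : (x - y) ^+ 2 * (1 - x / (x - y)) = y ^+ 2 - x * y by field.
by rewrite subr_gt0 (le_lt_trans xy).
Qed.

Definition planar_convex C := forall a b t, C a -> C b -> 0 <= t <= 1 ->
  C (segment_point t a b).

(** A point of least norm on the chords of [S] replaces the nearest point of the
    convex hull, which would require the hull to be closed. *)
Lemma planar_convex_compact_zero S C :
  compact S -> S `<=` C -> planar_convex C ->
  (forall q, exists2 z, S z & 0 <= dot q z) -> C (0, 0).
Proof.
move=> Scomp SC Cconv Shalf.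
have S0 : S !=set0 by have [z Sz _] := Shalf (0, 0); exists z.
have [a [b [s [Sa Sb s01 pmin]]]] := exists_min_norm_segment S0 Scomp.
set p := segment_point s a b in pmin.
have Cp : C p by apply: Cconv => //; exact: SC.
have pE1 : p.1 = (1 - s) * a.1 + s * b.1 by [].
have pE2 : p.2 = (1 - s) * a.2 + s * b.2 by [].
have [pp0|pp_neq0] := eqVneq (dot p p) 0.
  move: pp0 Cp; rewrite /dot -!expr2; case: (p) => p1 p2 /= /eqP.
  by rewrite paddr_eq0 ?sqr_ge0// !sqrf_eq0 => /andP[/eqP-> /eqP->].
have pp_gt0 : 0 < dot p p.
  by rewrite lt_def pp_neq0 /dot -!expr2 addr_ge0 ?sqr_ge0.
have [z Sz pz] := Shalf (- p.1, - p.2).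
have {}pz : dot p z <= 0.
  by move: pz; rewrite /dot/= !mulNr -opprD oppr_ge0.
(* otherwise the segment from p to z would come closer to 0 *)
have pNS : ~ S p.
  move=> Sp; have := dot_ge_of_min_norm (p := p) (b := z).
  have : forall t, 0 <= t <= 1 ->
    dot p p <= dot (segment_point t p z) (segment_point t p z).
    by move=> t t01; exact: pmin.
  by move=> h /(_ h); rewrite leNgt (le_lt_trans pz).
have s0 : 0 < s.
  rewrite lt_def; have /andP[-> _] := s01; rewrite andbT.
  apply/eqP => s0; apply: pNS; suff -> : p = a by [].
  by rewrite /p s0 /segment_point subr0 !mul1r !mul0r !addr0; case: (a).
have s1 : s < 1.
  rewrite lt_def; have /andP[_ ->] := s01; rewrite andbT.
  apply/eqP => s1; apply: pNS; suff -> : p = b by [].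
  by rewrite /p -s1 /segment_point subrr !mul1r !mul0r !add0r; case: (b).
have pa : dot p p <= dot p a.
  apply: dot_ge_of_min_norm => t /andP[t0 t1].
  have -> : segment_point t p a = segment_point (s * (1 - t)) a b.
    by rewrite /p /segment_point /=; congr pair; ring.
  apply: pmin => //; rewrite mulr_ge0 ?subr_ge0 ?(ltW s0)//=.
  have : 0 <= s * t by rewrite mulr_ge0// ltW.
  lra.
have pb : dot p p <= dot p b.
  apply: dot_ge_of_min_norm => t /andP[t0 t1].
  have -> : segment_point t p b = segment_point (s + t * (1 - s)) a b.
    by rewrite /p /segment_point /=; congr pair; ring.
  apply: pmin => //.
  rewrite addr_ge0 ?mulr_ge0 ?subr_ge0 ?(ltW s0) ?(ltW s1)//=.
  rewrite -subr_ge0 (_ : 1 - _ = (1 - s) * (1 - t)); last by ring.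
  by rewrite mulr_ge0 ?subr_ge0// ltW.
have pab : (1 - s) * dot p a + s * dot p b = dot p p.
  by rewrite [in RHS]/dot {2}pE1 {2}pE2 /dot; ring.
(* both summands are nonnegative, so dot p takes the value dot p p at a and b *)
have sum0 : (1 - s) * (dot p a - dot p p) + s * (dot p b - dot p p) = 0.
  transitivity ((1 - s) * dot p a + s * dot p b - dot p p); first by ring.
  by rewrite pab subrr.
have s1' : 0 < 1 - s by rewrite subr_gt0.
have [/eqP sa /eqP sb] : (1 - s) * (dot p a - dot p p) == 0 /\
    s * (dot p b - dot p p) == 0.
  apply/andP; rewrite -paddr_eq0 ?sum0//.
    by rewrite mulr_ge0 ?subr_ge0 ?(ltW s1).
  by rewrite mulr_ge0 ?subr_ge0 ?(ltW s0).
have {}pa : dot p a = dot p p.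
  by move/eqP: sa; rewrite mulf_eq0 gt_eqF//= subr_eq0 => /eqP.
have {}pb : dot p b = dot p p.
  by move/eqP: sb; rewrite mulf_eq0 gt_eqF//= subr_eq0 => /eqP.
have cab : (1 - s) * cross p a + s * cross p b = 0.
  transitivity (cross p p); last by rewrite /cross; ring.
  by rewrite [in RHS]/cross {2}pE1 {1}pE2 /cross; ring.
have crossN0 w : S w -> dot p w = dot p p -> cross p w != 0.
  move=> Sw pw; apply/eqP => pw0; apply: pNS; suff -> : p = w by [].
  have pw1 : dot p p * w.1 = dot p w * p.1 - cross p w * p.2.
    by rewrite /dot /cross; ring.
  have pw2 : dot p p * w.2 = dot p w * p.2 + cross p w * p.1.
    by rewrite /dot /cross; ring.
  move: pw1 pw2; rewrite pw pw0 !mul0r subr0 addr0.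
  move=> /(mulfI pp_neq0) w1 /(mulfI pp_neq0) w2.
  by rewrite [p]surjective_pairing -w1 -w2 -surjective_pairing.
(* p lies between a and b, so one of them is on the side opposite to z *)
have [w [Sw pw zw]] :
    exists w, [/\ S w, dot p w = dot p p & cross p z * cross p w <= 0].
  have [za|za] := leP (cross p z * cross p a) 0; first by exists a.
  exists b; split=> //; rewrite -(pmulr_rle0 _ s0).
  have : 0 < (1 - s) * (cross p z * cross p a) by rewrite mulr_gt0 ?subr_gt0.
  have : (1 - s) * (cross p z * cross p a) + s * (cross p z * cross p b) = 0.
    by rewrite -[RHS](mulr0 (cross p z)) -cab; ring.
  lra.
have [t /andP[t0 t1] pq] := segment_crosses_line (crossN0 w Sw pw) zw.
set q := segment_point t z w in pq.
have t01 : 0 <= t <= 1 by rewrite t0 ltW.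
have Cq : C q by apply: Cconv => //; exact: SC.
have dotq : dot p q = dot p p - (1 - t) * (dot p p - dot p z).
  transitivity ((1 - t) * dot p z + t * dot p w).
    by rewrite /q /dot /segment_point/=; ring.
  by rewrite pw; ring.
have dotq_lt : dot p q < dot p p.
  by rewrite dotq gtrBl mulr_gt0 ?subr_gt0// (le_lt_trans pz).
(* q is a multiple of p, with a factor < 1 by dotq_lt *)
have [q0|q0] := leP (dot p q) 0; last first.
  have := pmin z w t Sz Sw t01; rewrite -/q leNgt => /negP; case.
  rewrite -(ltr_pM2l pp_gt0).
  have -> : dot p p * dot q q = dot p q * dot p q + cross p q ^+ 2.
    by rewrite /dot /cross; ring.
  by rewrite pq expr0n addr0 ltr_pM// ltW.
have nD : dot p p - dot p q != 0 by rewrite subr_eq0 gt_eqF.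
have -> : (0, 0) = segment_point (- dot p q / (dot p p - dot p q)) q p.
  have q1 : dot p p * q.1 = dot p q * p.1.
    have : dot p p * q.1 = dot p q * p.1 - cross p q * p.2.
      by rewrite /dot /cross; ring.
    by rewrite pq mul0r subr0.
  have q2 : dot p p * q.2 = dot p q * p.2.
    have : dot p p * q.2 = dot p q * p.2 + cross p q * p.1.
      by rewrite /dot /cross; ring.
    by rewrite pq mul0r addr0.
  rewrite /segment_point; congr pair; apply/esym.
    transitivity ((dot p p * q.1 - dot p q * p.1) / (dot p p - dot p q)).
      by field.
    by rewrite q1 subrr mul0r.
  transitivity ((dot p p * q.2 - dot p q * p.2) / (dot p p - dot p q)).
    by field.
  by rewrite q2 subrr mul0r.
apply: Cconv => //.
rewrite divr_ge0 ?oppr_ge0 ?subr_ge0 ?(ltW dotq_lt)//=.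
by rewrite ler_pdivrMr ?subr_gt0// mul1r lerDr ltW.
Qed.

End ConvexHullOfPlanarCompact.

(** * Essential cluster values *)

Section EssentialClusters.
Context {d : measure_display} {X : measurableType d} {R : realType}.
Variable mu : {measure set X -> \bar R}.
Context {T : topologicalType}.
Implicit Types (A : R -> set X) (phi : X -> T) (B U : set T).

(** Negligibility is used rather than [mu _ = 0] so that the sets need not be
    measurable. *)
Definition essential_cluster A phi : set T :=
  [set p | forall e U, 0 < e -> nbhs p U ->
    ~ mu.-negligible (A e `&` phi @^-1` U)].

Lemma closed_essential_cluster A phi : closed (essential_cluster A phi).
Proof.
move=> p clp e U e0 /nbhs_interior pU.
have [p' [clp' Up']] := clp _ pU.
exact: clp' Up'.
Qed.

Lemma essential_cluster_sub A phi B : closed B ->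
  (\forall x \ae mu, B (phi x)) -> essential_cluster A phi `<=` B.
Proof.
move=> Bcl phiB p clp; apply: contrapT => Bp.
apply: (clp 1 (~` B)) => //.
  by apply: open_nbhs_nbhs; split => //; exact: closed_openC.
by apply: negligibleS phiB => x [_ /= nBx].
Qed.

(** The sets [V] such that, for some [e], almost every point of [A e] with value
    in [B] has its value in [V] form a proper filter; a cluster point of it is
    an essential cluster value. *)
Lemma essential_cluster_exists A phi B : compact B ->
  (forall e e', e <= e' -> A e `<=` A e') ->
  (forall e, 0 < e -> ~ mu.-negligible (A e `&` phi @^-1` B)) ->
  exists2 p, B p & essential_cluster A phi p.
Proof.
move=> Bcomp Amono Apos.
pose F := [set V : set T |
  exists2 e, 0 < e & mu.-negligible (A e `&` phi @^-1` (B `\` V))].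
have FF : ProperFilter F.
  split; first by case=> e e0; rewrite setD0; exact: Apos.
  split.
  - exists 1 => //; rewrite setDT preimage_set0 setI0.
    exact: negligible_set0.
  - move=> V W [e e0 Ve] [e' e'0 We]; exists (Num.min e e').
      by rewrite lt_min e0.
    apply: negligibleS (negligibleU Ve We) => x [Ax [Bx /= /not_andP[nV|nW]]].
      by left; split=> //; apply: Amono Ax; rewrite ge_min lexx.
    by right; split=> //; apply: Amono Ax; rewrite ge_min lexx orbT.
  - move=> V W VW [e e0 Ve]; exists e => //.
    by apply: negligibleS Ve => x [Ax [Bx nW]]; split=> //; split=> // /VW.
have FB : F B.
  by exists 1 => //; rewrite setDv preimage_set0 setI0; exact: negligible_set0.
have [p [Bp Fp]] := Bcomp F FF FB.
exists p => // e U e0 pU Uneg.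
have FU : F (~` U).
  by exists e => //; apply: negligibleS Uneg => x [Ax [_ /contrapT Ux]].
by have [y []] := Fp _ _ FU pU.
Qed.

Lemma essential_clusterS A A' phi : (forall e, 0 < e -> A e `<=` A' e) ->
  essential_cluster A phi `<=` essential_cluster A' phi.
Proof.
move=> AA' p clp e U e0 pU A'neg; apply: (clp e U) => //.
by apply: negligibleS A'neg; apply: setSI; exact: AA'.
Qed.

End EssentialClusters.

(** * Real coordinates on the scalars *)

Section Coordinates.
Variables (R : realType) (k : scalar_kind).
Local Notation K := (scalars R k).
Implicit Types z w : K.

Definition re_part : K -> R :=
  match k return scalars R k -> R with
  | RealScalars => fun x : R => x
  | ComplexScalars => fun z : R[i] => complex.Re z
  end.

Definition im_part : K -> R :=
  match k return scalars R k -> R with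
  | RealScalars => fun=> 0
  | ComplexScalars => fun z : R[i] => complex.Im z
  end.

Definition of_real : R -> K :=
  match k return R -> scalars R k with
  | RealScalars => fun x : R => x
  | ComplexScalars => fun x : R => (x +i* 0)%C
  end.

Definition coords z : R * R := (re_part z, im_part z).
End Coordinates.

Arguments of_real {R} k x.

Section CoordinateTheory.
Variables (R : realType) (k : scalar_kind).
Local Notation K := (scalars R k).
Implicit Types (x : R) (z w : K).

Lemma re_partD z w : re_part (z + w) = re_part z + re_part w.
Proof. by case: k z w => // -[a b] [c d]. Qed.
Lemma im_partD z w : im_part (z + w) = im_part z + im_part w.
Proof. by case: k z w => [z w|[a b] [c d]] //=; rewrite addr0. Qed.
Lemma re_partN z : re_part (- z) = - re_part z.
Proof. by case: k z => // -[a b]. Qed.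
Lemma im_partN z : im_part (- z) = - im_part z.
Proof. by case: k z => [z|[a b]] //=; rewrite oppr0. Qed.
Lemma re_partM z w : re_part (z * w) =
  re_part z * re_part w - im_part z * im_part w.
Proof. by case: k z w => [z w|[a b] [c d]] //=; rewrite mulr0 subr0. Qed.
Lemma im_partM z w : im_part (z * w) =
  re_part z * im_part w + im_part z * re_part w.
Proof. by case: k z w => [z w|[a b] [c d]] //=; rewrite mulr0 mul0r addr0. Qed.
Lemma re_part_conj z : re_part (conjugate z) = re_part z.
Proof. by case: k z => // -[a b]. Qed.
Lemma im_part_conj z : im_part (conjugate z) = - im_part z.
Proof. by case: k z => [z|[a b]] //=; rewrite oppr0. Qed.
Lemma re_part_of_real x : re_part (of_real k x) = x.
Proof. by case: k. Qed.
Lemma im_part_of_real x : im_part (of_real k x) = 0.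
Proof. by case: k. Qed.

Lemma modulusE z : modulus z = Num.sqrt (re_part z ^+ 2 + im_part z ^+ 2).
Proof.
case: k z => [z|z]; last by rewrite /modulus normc_def.
by rewrite /= expr0n addr0 sqrtr_sqr.
Qed.

Lemma modulus_ge0 z : 0 <= modulus z.
Proof. by rewrite modulusE sqrtr_ge0. Qed.

Lemma sqr_modulus z : modulus z ^+ 2 = re_part z ^+ 2 + im_part z ^+ 2.
Proof. by rewrite modulusE sqr_sqrtr// addr_ge0 ?sqr_ge0. Qed.

Lemma modulusD z w : modulus (z + w) <= modulus z + modulus w.
Proof.
case: k z w => [z w|z w] /=; first exact: ler_normD.
by have := ler_normD z w; rewrite lecE => /andP[_].
Qed.

Lemma modulusM z w : modulus (z * w) = modulus z * modulus w.
Proof.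
apply/eqP; rewrite -(eqrXn2 (n := 2))// ?mulr_ge0 ?modulus_ge0//.
by rewrite exprMn !sqr_modulus re_partM im_partM; apply/eqP; ring.
Qed.

Lemma modulus_conj z : modulus (conjugate z) = modulus z.
Proof. by rewrite !modulusE re_part_conj im_part_conj sqrrN. Qed.

Lemma modulus_of_real x : modulus (of_real k x) = `|x|.
Proof.
by rewrite modulusE re_part_of_real im_part_of_real expr0n addr0 sqrtr_sqr.
Qed.

Lemma norm_re_part_le z : `|re_part z| <= modulus z.
Proof.
by rewrite -sqrtr_sqr modulusE ler_wsqrtr// lerDl sqr_ge0.
Qed.

Lemma norm_im_part_le z : `|im_part z| <= modulus z.
Proof.
by rewrite -sqrtr_sqr modulusE ler_wsqrtr// lerDr sqr_ge0.
Qed.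

Lemma modulus_le_coords z : modulus z <= `|re_part z| + `|im_part z|.
Proof.
rewrite -ler_sqr ?nnegrE ?addr_ge0 ?modulus_ge0//.
rewrite sqr_modulus -[X in X + _ <= _]real_normK ?num_real//.
rewrite -[X in _ + X <= _]real_normK ?num_real//.
by rewrite sqrrD lerD2r lerDl mulrn_wge0// mulr_ge0.
Qed.

Lemma sqr_modulusD z w : modulus (z + w) ^+ 2 =
  modulus z ^+ 2 + 2 * re_part (conjugate z * w) + modulus w ^+ 2.
Proof.
rewrite !sqr_modulus re_partD im_partD re_partM re_part_conj im_part_conj.
by ring.
Qed.

Lemma coords_inj : injective (@coords R k).
Proof. by case: k => [x y []|[a b] [c d] [/= -> ->]]. Qed.

(** Over the complex numbers [a] is the conjugate of [q]; over the reals
    [coords z] lies on the first axis, and [a] is [q.1]. *)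
Lemma half_plane_functional (q : R * R) :
  exists a : K, forall z, re_part (a * z) = dot q (coords z).
Proof.
rewrite /dot /coords; case: k => /=.
  by exists q.1 => z /=; rewrite mulr0 addr0.
by exists (q.1 +i* - q.2)%C => -[x y] /=; rewrite mulNr opprK.
Qed.

(** In the order of the complex numbers, [0 <= t] forces [t] to be real. *)
Lemma i01_of_real (t : {i01 K}) :
  exists2 s, 0 <= s <= 1 & t%:num = of_real k s.
Proof.
have t0 : 0 <= t%:num by [].
have t1 : t%:num <= 1 by [].
case: k t t0 t1 => [t t0 t1|t]; first by exists t%:num => //; apply/andP.
case: (t%:num) => a b /=.
rewrite !lecE /= => /andP[/eqP -> a0] /andP[_ a1].
by exists a => //; apply/andP.
Qed.

Lemma of_real_i01 (s : R) : 0 <= s <= 1 ->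
  exists t : {i01 K}, t%:num = of_real k s.
Proof.
move=> /andP[s0 s1].
have t0 : 0 <= of_real k s.
  by case: k => //=; rewrite lecE/= eqxx.
have t1 : of_real k s <= 1.
  by case: k => //=; rewrite lecE/= eqxx.
by exists (Itv01 t0 t1).
Qed.
End CoordinateTheory.

(** * Norming values as essential cluster values *)

Section NormingValues.
Variables (R : realType) (k : scalar_kind).
Local Notation K := (scalars R k).

Lemma near_modulus_lt (p : K) (e : R) : 0 < e ->
  \forall q \near (p : K), modulus (p - q) < e.
Proof.
move=> e0; apply/nbhs_ballP; case: k p => p.
  by exists e => //= q.
exists (e +i* 0)%C => /=.
  by rewrite ltcE/= eqxx.
move=> q.
by rewrite -ball_normE /= ltcE /= => /andP[_].
Qed.

Lemma continuous_re_part : continuous (@re_part R k).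
Proof.
move=> p; apply/(@cvgrPdist_lt _ _ _ _ (nbhs_filter p)) => e e0.
near=> q.
rewrite -re_partN -re_partD (le_lt_trans (norm_re_part_le _))//.
by near: q; exact: near_modulus_lt.
Unshelve. all: by end_near. Qed.

Lemma continuous_im_part : continuous (@im_part R k).
Proof.
move=> p; apply/(@cvgrPdist_lt _ _ _ _ (nbhs_filter p)) => e e0.
near=> q.
rewrite -im_partN -im_partD (le_lt_trans (norm_im_part_le _))//.
by near: q; exact: near_modulus_lt.
Unshelve. all: by end_near. Qed.

Lemma measurable_continuous_borel d (X : measurableType d) (u : K -> R)
  (h : X -> K) : continuous u -> measurable_fun setT (h : X -> borel K) ->
  measurable_fun setT (u \o h).
Proof.
move=> /continuousP cu mh.
apply: (measurability _ (RGenOInfty.measurableE R)) => //.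
move=> _ [_ [x ->] <-]; rewrite comp_preimage.
apply: mh => //.
by apply: sub_sigma_algebra; apply: cu; exact: interval_open.
Qed.

Context {d : measure_display} {X : measurableType d}.
Implicit Types f g h : X -> K.

Lemma measurable_modulus h :
  measurable_fun setT (fun x => re_part (h x)) ->
  measurable_fun setT (fun x => im_part (h x)) ->
  measurable_fun setT (fun x => modulus (h x)).
Proof.
move=> mr mi.
rewrite (_ : (fun x => _) =
  Num.sqrt \o (fun x => re_part (h x) ^+ 2 + im_part (h x) ^+ 2)); last first.
  by apply/funext => x; rewrite modulusE.
apply: measurableT_comp.
  by apply: continuous_measurable_fun; exact: sqrt_continuous.
by apply: measurable_funD; apply: measurable_funX.
Qed.

Lemma measurable_norming f g (M e : R) (z : K) :
  measurable_fun setT (f : X -> borel K) ->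
  measurable_fun setT (g : X -> borel K) ->
  measurable [set x | M - e < modulus (f x) /\
                      modulus (conjugate (f x) * g x - z) < e].
Proof.
move=> mf mg.
have mf1 := measurable_continuous_borel continuous_re_part mf.
have mf2 := measurable_continuous_borel continuous_im_part mf.
have mg1 := measurable_continuous_borel continuous_re_part mg.
have mg2 := measurable_continuous_borel continuous_im_part mg.
have mm := measurable_modulus mf1 mf2.
have mz : measurable_fun setT (fun x => modulus (conjugate (f x) * g x - z)).
  apply: measurable_modulus.
    under eq_fun do rewrite re_partD re_partM re_part_conj im_part_conj.
    apply: measurable_funD => //.
    apply: measurable_funB; apply: measurable_funM => //.
    exact: measurable_funN.
  under eq_fun do rewrite im_partD im_partM re_part_conj im_part_conj.
  apply: measurable_funD => //.
  apply: measurable_funD; apply: measurable_funM => //.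
  exact: measurable_funN.
rewrite [X in measurable X](_ : _ =
  (fun x => modulus (f x)) @^-1` `]M - e, +oo[ `&`
  (fun x => modulus (conjugate (f x) * g x - z)) @^-1` `]-oo, e[); last first.
  by apply/seteqP; split => x /=; rewrite !in_itv/= andbT.
apply: measurableI; rewrite -[X in measurable X]setTI.
  exact: mm.
exact: mz.
Qed.

Variable mu : {measure set X -> \bar R}.

Lemma gt0_measureP (A : set X) : measurable A ->
  (0 < mu A)%E <-> ~ mu.-negligible A.
Proof.
move=> mA; rewrite negligibleP// lt0e measure_ge0 andbT.
by split => [/eqP|/eqP].
Qed.

Lemma Linfty_norm_leP h (r : R) : (0 < mu setT)%E ->
  (Linfty_norm mu h <= r%:E)%E <-> \forall x \ae mu, modulus (h x) <= r.
Proof.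
move=> mu0; rewrite /Linfty_norm unlock mu0.
split => [/ess_supP|] hr; last apply/ess_supP; apply: filterS hr => x /=;
  by rewrite lee_fin ger0_norm ?modulus_ge0.
Qed.

Lemma Linfty_norm_fin h : Linfty mu h ->
  exists2 M : R, 0 <= M & Linfty_norm mu h = M%:E.
Proof.
move=> [_ hfin]; exists (fine (Linfty_norm mu h)).
  by rewrite fine_ge0 ?Lnorm_ge0.
by rewrite fineK// ge0_fin_numE ?Lnorm_ge0.
Qed.

Lemma closed_range_coords : closed (range (@coords R k)).
Proof.
case: k => [|]; last first.
  rewrite (_ : range _ = setT); first exact: closedT.
  by apply/seteqP; split => // -[x y] _; exists (x +i* y)%C.
rewrite (_ : range _ = snd @^-1` [set 0]); last first.
  by apply/seteqP; split => [_ [x _ <-]//|[x y] /= ->]; exists x.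
apply: closed_comp => [? _|]; first exact: cvg_snd.
exact: closed_eq.
Qed.

(** The modulus and the sup norm of the coordinates are equivalent, so the discs
    of the definition may be replaced by neighborhoods in the plane; by
    measurability, positive measure means not negligible. *)
Lemma norming_valuesP f g (M : R) z : Linfty mu f -> Linfty mu g ->
  Linfty_norm mu f = M%:E ->
  norming_values mu f g z <->
  essential_cluster mu (fun e => [set x | M - e < modulus (f x)])
    (fun x => coords (conjugate (f x) * g x)) (coords z).
Proof.
move=> [mf _] [mg _] fM; rewrite /norming_values/= fM.
have E e : [set x | ((M%:E - e%:E < (modulus (f x))%:E)%E /\
      modulus (conjugate (f x) * g x - z) < e)%R] =
    [set x | M - e < modulus (f x) /\
      modulus (conjugate (f x) * g x - z) < e].
  by apply/seteqP; split => x /=; rewrite -EFinB lte_fin.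
split=> [zN e U e0 /nbhs_ballP[r r0 rU]|clz e e0].
  have er0 : 0 < Num.min e r by rewrite lt_min e0.
  have := zN _ er0; rewrite E (gt0_measureP (measurable_norming _ _ _ mf mg)).
  apply: contra_not; apply: negligibleS => x [/= xM xz]; split=> /=.
    by apply: le_lt_trans xM; rewrite lerB// ge_min lexx.
  have {}xz : modulus (conjugate (f x) * g x - z) < r.
    by apply: lt_le_trans xz _; rewrite ge_min lexx orbT.
  apply: rU; split; rewrite /= -ball_normE/= distrC.
    by rewrite -re_partN -re_partD (le_lt_trans (norm_re_part_le _)).
  by rewrite -im_partN -im_partD (le_lt_trans (norm_im_part_le _)).
rewrite E (gt0_measureP (measurable_norming _ _ _ mf mg)).
have e20 : 0 < e / 2 by rewrite divr_gt0.
have := clz _ _ e0 (nbhsx_ballx (coords z) _ e20).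
apply: contra_not; apply: negligibleS => x [/= xM [xr xi]]; split => //.
apply: le_lt_trans (modulus_le_coords _) _.
rewrite (splitr e) ltrD//.
  by move: xr; rewrite -ball_normE/= distrC re_partD re_partN.
by move: xi; rewrite -ball_normE/= distrC im_partD im_partN.
Qed.

(** Over the reals, an essential cluster value in the plane lies on the real
    axis because the range of [coords] is closed. *)
Lemma norming_coordsE f g (M : R) : Linfty mu f -> Linfty mu g ->
  Linfty_norm mu f = M%:E ->
  [set coords z | z in norming_values mu f g] =
  essential_cluster mu (fun e => [set x | M - e < modulus (f x)])
    (fun x => coords (conjugate (f x) * g x)).
Proof.
move=> hf hg fM; apply/seteqP; split=> [_ [z zN <-]|p clp].
  exact/(norming_valuesP _ hf hg fM).
have [z _ zp] : range (@coords R k) p.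
  apply: essential_cluster_sub clp; first exact: closed_range_coords.
  by apply: aeW => x; exists (conjugate (f x) * g x).
by exists z => //; apply/(norming_valuesP _ hf hg fM); rewrite zp.
Qed.

End NormingValues.

(** * Convexity in the scalar field *)

Section Convexity.
Variables (R : realType) (k : scalar_kind).
Local Notation K := (scalars R k).

Lemma re_part_scale (s : R) (z : K) : re_part (of_real k s * z) = s * re_part z.
Proof. by rewrite re_partM re_part_of_real im_part_of_real mul0r subr0. Qed.

Lemma im_part_scale (s : R) (z : K) : im_part (of_real k s * z) = s * im_part z.
Proof. by rewrite im_partM re_part_of_real im_part_of_real mul0r addr0. Qed.

Lemma of_realB1 (s : R) : 1 - of_real k s = of_real k (1 - s).
Proof. by case: k => //=; apply/eqP; rewrite eq_complex/= subr0 !eqxx. Qed.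

Lemma coords_conv (t : {i01 K}) (s : R) (z w : K) :
  t%:num = of_real k s ->
  coords ((conv t (z : convex_lmodType K^o) (w : convex_lmodType K^o)) : K) =
  segment_point s (coords w) (coords z).
Proof.
move=> ts; rewrite /coords /segment_point/=.
have -> : conv t (z : convex_lmodType K^o) (w : convex_lmodType K^o) =
   of_real k s * z + of_real k (1 - s) * w :> K.
  by rewrite -of_realB1 -ts.
by rewrite re_partD im_partD !re_part_scale !im_part_scale !(addrC (s * _)).
Qed.

Lemma planar_convex_coords (C : set K) : @convex_set K K^o C ->
  planar_convex [set coords z | z in C].
Proof.
move=> Cconv _ _ s [z Cz <-] [w Cw <-] s01.
have [t ts] := of_real_i01 k s01.
exists (conv t (w : convex_lmodType K^o) (z : convex_lmodType K^o)).
  by rewrite -inE; apply: Cconv; rewrite inE.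
exact: coords_conv.
Qed.

Lemma convex_convex_hull (S : set K) : @convex_set K K^o (convex_hull S).
Proof.
move=> z w t; rewrite !inE => Sz Sw C CS.
by rewrite -inE; apply: CS.1; rewrite inE; [exact: Sz|exact: Sw].
Qed.

(** The open half-plane [re_part (a * z) < 0] is convex and misses 0. *)
Lemma convex_hull_half_plane (S : set K) (a : K) : convex_hull S 0 ->
  exists2 z, S z & 0 <= re_part (a * z).
Proof.
move=> S0; apply: contrapT => nz.
pose C := [set z : K | re_part (a * z) < 0].
suff : C 0 by rewrite /C/= mulr0; case: k => /=; rewrite ltxx.
apply: (smallest_sub _ _ S0).
  move=> z w t; rewrite !inE /C/= => az aw.
  have [s /andP[s0 s1] ts] := i01_of_real t.
  have -> : a * conv t (z : convex_lmodType K^o) (w : convex_lmodType K^o) =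
     of_real k s * (a * z) + of_real k (1 - s) * (a * w) :> K.
    rewrite -of_realB1 -ts.
    transitivity (a * (t%:num * z + (1 - t%:num) * w)) => //.
    by ring.
  rewrite re_partD !re_part_scale.
  have [->|sN0] := eqVneq s 0; first by rewrite mul0r add0r subr0 mul1r.
  rewrite ltr_nwDl//; first by rewrite nmulr_llt0// lt_def sN0.
  by rewrite nmulr_lle0 ?subr_ge0.
move=> z Sz; rewrite /C/= ltNge; apply/negP => az.
by apply: nz; exists z.
Qed.

End Convexity.

(** * Birkhoff-James orthogonality and half-planes *)

Section Orthogonality.
Variables (R : realType) (k : scalar_kind).
Local Notation K := (scalars R k).

Lemma sqr_modulus_perturb (a u v : K) (t : R) :
  modulus (u + of_real k t * a * v) ^+ 2 =
  modulus u ^+ 2 + 2 * t * re_part (a * (conjugate u * v)) +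
  (t * modulus a * modulus v) ^+ 2.
Proof.
rewrite sqr_modulusD !modulusM modulus_of_real.
rewrite (_ : conjugate u * _ = of_real k t * (a * (conjugate u * v)));
  last by ring.
by rewrite re_part_scale mulrA !exprMn real_normK ?num_real.
Qed.

(** If a perturbation of [u] of size [t] loses at most [t ^+ 2] from the bound
    [M], then [u] is itself nearly of modulus [M], and, after division of
    [sqr_modulus_perturb] by [t], the first-order term is nearly nonnegative. *)
Lemma large_perturbation (a u v : K) (M G e t : R) :
  modulus u <= M -> modulus v <= G -> 0 < t <= 1 ->
  t * (2 + M + modulus a * G + (modulus a * G) ^+ 2) < e ->
  M - t ^+ 2 < modulus (u + of_real k t * a * v) ->
  M - e < modulus u /\ - e < re_part (a * (conjugate u * v)).
Proof.
move=> uM vG /andP[t0 t1] te Hlt.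
have u0 := modulus_ge0 u; have v0 := modulus_ge0 v; have a0 := modulus_ge0 a.
have M0 : 0 <= M by exact: le_trans uM.
set c := modulus a * G in te *.
have wc : modulus a * modulus v <= c by rewrite ler_wpM2l.
have w0 : 0 <= modulus a * modulus v by rewrite mulr_ge0.
have c0 : 0 <= c by exact: le_trans wc.
clearbody c.
have tM0 : 0 <= t * M by rewrite mulr_ge0 ?(ltW t0).
have tc20 : 0 <= t * c ^+ 2 by rewrite mulr_ge0 ?(ltW t0) ?sqr_ge0.
have tc0 : 0 <= t * c by rewrite mulr_ge0 ?(ltW t0).
have tt : t ^+ 2 <= t by rewrite expr2 ler_piMr// ltW.
have te' : t * 2 + t * M + t * c + t * c ^+ 2 < e by rewrite -!mulrDr.
split.
  have : modulus (u + of_real k t * a * v) <= modulus u + t * c.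
    rewrite (le_trans (modulusD _ _))// lerD2l -mulrA modulusM modulus_of_real.
    by rewrite modulusM gtr0_norm// ler_wpM2l// ltW.
  lra.
have := sqr_modulus_perturb a u v t.
have := modulus_ge0 (u + of_real k t * a * v).
move: (modulus (u + _)) Hlt => H Hlt H0 HE.
have H2 : M ^+ 2 - 2 * M * t ^+ 2 <= H ^+ 2.
  move: (t ^+ 2) Hlt (sqr_ge0 t) => t2 Hlt t20.
  have [Mt|Mt] := leP t2 M.
    have : (M - t2) ^+ 2 <= H ^+ 2.
      by rewrite lerXn2r ?nnegrE ?subr_ge0// ltW.
    have := sqr_ge0 t2; lra.
  apply: le_trans (sqr_ge0 _).
  rewrite (_ : _ - _ = M * (M - 2 * t2)); last by ring.
  by rewrite mulr_ge0_le0//; lra.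
have u2 : modulus u ^+ 2 <= M ^+ 2 by rewrite lerXn2r ?nnegrE.
have w2 : (t * modulus a * modulus v) ^+ 2 <= t ^+ 2 * c ^+ 2.
  by rewrite -mulrA exprMn ler_wpM2l ?sqr_ge0// lerXn2r ?nnegrE.
rewrite -(ltr_pM2l t0).
have : 2 * (t * re_part (a * (conjugate u * v))) >=
   - t * (t * c ^+ 2 + 2 * (t * M)).
  have -> : - t * (t * c ^+ 2 + 2 * (t * M)) =
    - (t ^+ 2 * c ^+ 2 + 2 * M * t ^+ 2) by ring.
  lra.
have : t * (t * c ^+ 2 + 2 * (t * M)) < t * (2 * e).
  rewrite ltr_pM2l//; lra.
lra.
Qed.

Context {d : measure_display} {X : measurableType d}.
Variable mu : {measure set X -> \bar R}.
Context (mu0 : (0 < mu setT)%E) {f g : X -> K}.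
Context (hf : Linfty mu f) (hg : Linfty mu g).
Let phi x : K := conjugate (f x) * g x.

(** If the norm of [h = f + a g] were [r < M], then [|h|] would exceed [r] on
    the set attached to a norming value [z] with [re_part (a * z) >= 0]. *)
Lemma norming_half_plane_birkhoff :
  (forall a, exists2 z, norming_values mu f g z & 0 <= re_part (a * z)) ->
  birkhoff_james (Linfty_norm mu) f g.
Proof.
move=> half a; rewrite leNgt; apply/negP.
set h := (f + a *: g)%R => hlt.
have [M M0 fM] := Linfty_norm_fin hf.
have h0 : (0 <= Linfty_norm mu h)%E by exact: Lnorm_ge0.
rewrite fM in hlt.
have hfin : Linfty_norm mu h \is a fin_num.
  by rewrite ge0_fin_numE// (lt_trans hlt) ?ltry.
move: h0 hlt; rewrite -(fineK hfin) lee_fin lte_fin.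
set r := fine _ => r0 rM.
have hr : \forall x \ae mu, modulus (h x) <= r.
  by apply/(Linfty_norm_leP _ _ mu0); rewrite fineK.
have [z zN az] := half a.
have [del del0 Mdel] : exists2 del : R, 0 < del & M = r + del.
  by exists (M - r); rewrite ?subr_gt0// addrC subrK.
have a0 := modulus_ge0 a.
(* e is chosen so that r ^+ 2 + 2 * modulus a * e < (M - e) ^+ 2 *)
pose D : R := 4 * del + 16 * modulus a.
have D0 : 0 < D by rewrite ltr_pwDl ?mulr_gt0// mulr_ge0.
pose e : R := del ^+ 2 / D.
have eD : e * D = del ^+ 2 by rewrite divfK ?gt_eqF.
have e0 : 0 < e by rewrite divr_gt0// exprn_gt0.
have := zN e e0; rewrite fM.
have [[mf _] [mg _]] := (hf, hg).
under [X in mu X]eq_set do rewrite -EFinB lte_fin.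
rewrite (gt0_measureP _ (measurable_norming _ _ _ mf mg)); apply.
apply: negligibleS hr => x [/= xM xz]; apply/negP; rewrite -ltNge.
have -> : h x = f x + a * g x by [].
rewrite -ltr_sqr ?nnegrE ?modulus_ge0// sqr_modulusD.
have -> : conjugate (f x) * (a * g x) = a * (phi x - z) + a * z.
  by rewrite /phi; ring.
rewrite re_partD.
have aphi : - (modulus a * e) <= re_part (a * (phi x - z)).
  have := norm_re_part_le (a * (phi x - z)); rewrite modulusM ler_norml.
  move=> /andP[+ _]; apply: le_trans; rewrite lerN2 ler_wpM2l// ltW//.
have g2 := sqr_ge0 (modulus (a * g x)).
have small : e * 4 * del + 16 * (modulus a * e) = del ^+ 2.
  by rewrite -eD /D; ring.
have e4 : e * 4 <= del.
  by rewrite -(ler_pM2r del0) -expr2 -small lerDl mulr_ge0// mulr_ge0// ltW.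
clearbody e r.
have Me : 0 <= M - e by lra.
have : (M - e) ^+ 2 <= modulus (f x) ^+ 2.
  by rewrite lerXn2r ?nnegrE ?modulus_ge0// ltW.
have : r ^+ 2 + 2 * (modulus a * e) < (M - e) ^+ 2.
  have -> : (M - e) ^+ 2 = r ^+ 2 + (del - e) * (2 * r + del - e).
    by rewrite Mdel; ring.
  rewrite ltrD2l.
  have de : del / 2 <= del - e by lra.
  have : (del / 2) * (del / 2) <= (del - e) * (2 * r + del - e).
    rewrite ler_pM ?divr_ge0 ?ltW//; lra.
  have -> : del / 2 * (del / 2) = del ^+ 2 / 4 by field.
  have : 0 < del ^+ 2 by rewrite exprn_gt0.
  have : 0 <= e * 4 * del by rewrite !mulr_ge0 ?ltW.
  lra.
lra.
Qed.

Lemma essential_modulus_bound (h : X -> K) : Linfty mu h ->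
  exists2 M : R, Linfty_norm mu h = M%:E & \forall x \ae mu, modulus (h x) <= M.
Proof.
move=> /Linfty_norm_fin[M _ hM]; exists M => //.
by apply/Linfty_norm_leP; rewrite ?hM.
Qed.

Lemma ae_coords_box (M G : R) :
  (\forall x \ae mu, modulus (f x) <= M) ->
  (\forall x \ae mu, modulus (g x) <= G) ->
  \forall x \ae mu, (`[- (M * G), M * G] `*` `[- (M * G), M * G])%classic
    (coords (phi x)).
Proof.
move=> fM gG; apply: filterS2 fM gG => x fM gG.
have : modulus (phi x) <= M * G.
  by rewrite modulusM modulus_conj ler_pM ?modulus_ge0.
move=> phiMG; split => /=; rewrite in_itv/= -ler_norml.
  exact: le_trans (norm_re_part_le _) _.
exact: le_trans (norm_im_part_le _) _.
Qed.

Lemma compact_box (c : R) : compact (`[- c, c] `*` `[- c, c])%classic.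
Proof. by apply: compact_setX; exact: segment_compact. Qed.

(** The norming value is found as an essential cluster value along sets [A e] on
    which, in addition, [re_part (a * phi x) > - e]: that condition passes to
    the limit, and the sets are not negligible by orthogonality. *)
Lemma birkhoff_norming_half_plane (a : K) :
  birkhoff_james (Linfty_norm mu) f g ->
  exists2 z, norming_values mu f g z & 0 <= re_part (a * z).
Proof.
move=> fg.
have [M fM faeM] := essential_modulus_bound hf.
have [G gG gaeG] := essential_modulus_bound hg.
have box := ae_coords_box faeM gaeG.
set B := (X in \forall x \ae mu, X _) in box.
pose A e := [set x | M - e < modulus (f x) /\ - e < re_part (a * phi x)].
have [|e e0 Aneg|p Bp Ap] :=
  @essential_cluster_exists _ _ _ mu _ A (fun x => coords (phi x)) _
    (@compact_box (M * G)).
- move=> e e' ee' x [xM xa]; split.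
    by apply: le_lt_trans xM; rewrite lerD2l lerN2.
  by apply: le_lt_trans xa; rewrite lerN2.
- have M0 : 0 <= M.
    by have [M' M'0] := Linfty_norm_fin hf; rewrite fM => -[->].
  have G0 : 0 <= G.
    by have [G' G'0] := Linfty_norm_fin hg; rewrite gG => -[->].
  have a0 := modulus_ge0 a.
  pose C := 2 + M + modulus a * G + (modulus a * G) ^+ 2.
  have C0 : 0 < C.
    rewrite /C; have := sqr_ge0 (modulus a * G).
    have : 0 <= modulus a * G by rewrite mulr_ge0.
    lra.
  (* then t <= 1 and t * C < e *)
  pose t := e / (C + e).
  have Ce0 : 0 < C + e by rewrite addr_gt0.
  have t0 : 0 < t by rewrite divr_gt0.
  have t1 : t <= 1 by rewrite ler_pdivrMr// mul1r lerDr ltW.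
  have tC : t * C < e.
    have : t * (C + e) = e by rewrite /t divfK ?gt_eqF.
    rewrite mulrDr; have : 0 < t * e by rewrite mulr_gt0.
    lra.
  have := fg (of_real k t * a); rewrite fM.
  set h := (f + _ *: g)%R => Mh.
  have : (Linfty_norm mu h <= (M - t ^+ 2)%:E)%E.
    apply/(Linfty_norm_leP _ _ mu0).
    apply: negligibleS
      (negligibleU Aneg (negligibleU box (negligibleU faeM gaeG))).
    move=> x /= /negP; rewrite -ltNge => hx.
    have [Bx|] := pselect (B (coords (phi x))); last by right; left.
    have [fx|/negP] := boolP (modulus (f x) <= M); last by do 2 right; left.
    have [gx|/negP] := boolP (modulus (g x) <= G); last by do 3 right.
    left; split => //=; apply: (large_perturbation fx gx _ tC hx).
    by rewrite t0.
  move=> /(le_trans Mh); rewrite lee_fin.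
  by rewrite lerDl oppr_ge0 leNgt exprn_gt0.
have [z zN zp] : [set coords z | z in norming_values mu f g] p.
  rewrite (norming_coordsE hf hg fM).
  by apply: essential_clusterS Ap => e e0 x [].
exists z => //.
rewrite leNgt; apply/negP => az.
(* near coords z the functional stays below half its value at z, and on A e, for
   e the opposite of that half, it stays above *)
have az2 : 0 < - re_part (a * z) / 2 by rewrite divr_gt0// oppr_gt0.
pose U := [set q : R * R |
  re_part a * q.1 - im_part a * q.2 < re_part (a * z) / 2].
have cU : (fun q : R * R => re_part a * q.1 - im_part a * q.2) @ p -->
    re_part (a * z).
  rewrite re_partM -zp; apply: cvgB; apply: cvgM; try exact: cvg_cst.
    exact: cvg_fst.
  exact: cvg_snd.
apply: (Ap _ U az2).
  by apply: (cvgr_lt _ cU); lra.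
rewrite (_ : _ `&` _ = set0); first exact: negligible_set0.
apply/seteqP; split => // x [/= [_]].
rewrite mulNr opprK /U/= => h1; rewrite -re_partM => h2.
by have := lt_trans h1 h2; rewrite ltxx.
Qed.

Lemma compact_norming_coords :
  compact [set coords z | z in norming_values mu f g].
Proof.
have [M fM faeM] := essential_modulus_bound hf.
have [G gG gaeG] := essential_modulus_bound hg.
have box := ae_coords_box faeM gaeG.
rewrite (norming_coordsE hf hg fM).
apply: (subclosed_compact _ (@compact_box (M * G))).
  exact: closed_essential_cluster.
apply: essential_cluster_sub box.
exact: compact_closed (@compact_box _).
Qed.

End Orthogonality.

Theorem theorem2p2p1 (R : realType) (k : scalar_kind)
    (d : measure_display) (X : measurableType d)
    (lambda : {measure set X -> \bar R}) (f g : X -> scalars R k)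
    (hf : Linfty lambda f) (hg : Linfty lambda g)
    (f_neq0 : ~ (f = cst 0 %[ae lambda]))
    (g_neq0 : ~ (g = cst 0 %[ae lambda])) :
  birkhoff_james (Linfty_norm lambda) f g <->
  convex_hull (norming_values lambda f g) 0.
Proof.
have mu0 : (0 < lambda setT)%E.
  rewrite lt0e measure_ge0 andbT; apply/eqP => mu0; apply: f_neq0.
  exact: ae_eq0.
split=> [fg|hull0]; last first.
  apply: norming_half_plane_birkhoff => // a.
  exact: convex_hull_half_plane.
set S := norming_values _ _ _.
have [|||q|z hz [z1 z2]] := @planar_convex_compact_zero R
    [set coords z | z in S] [set coords z | z in convex_hull S].
- exact: compact_norming_coords.
- by apply: image_subset; exact: sub_smallest.
- apply: planar_convex_coords; exact: convex_convex_hull.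
- have [a aE] := half_plane_functional k q.
  have [z zS az] := birkhoff_norming_half_plane mu0 hf hg a fg.
  by exists (coords z); [exists z|rewrite -aE].
suff <- : z = 0 by [].
by apply: coords_inj; rewrite /coords z1 z2; case: (k).
Qed.
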